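(* Let $N,M\ge 1$ be integers, let $\mathscr{A}$ be a finite set of real $(N\times M)$-matrices and let $\mathscr{B}$ be a finite set of real $(M\times N)$-matrices such that $$\det(AB)\neq 0\qquad\text{for all } A\in\mathscr{A},\ B\in\mathscr{B}.$$ Suppose that every sequence $\{A_n\}\in\mathscr{A}^{\infty}$ is $\mathscr{B}$-right-bounded. Then there exists a constant $C>0$ such that for every sequence $\{A_n\}\in\mathscr{A}^{\infty}$ there is a sequence $\{B_n\}\in\mathscr{B}^{\infty}$ with $$\|A_nB_n\cdots A_1B_1\|\le C\qquad\text{for all } n=1,2,\ldots.$$
   Context: For a set of matrices $\mathscr{M}$, $\mathscr{M}^{\infty}$ denotes the set of infinite sequences $\{M_i\}_{i\ge1}$ with $M_i\in\mathscr{M}$. $\|\cdot\|$ denotes a fixed norm on the space of real $(N\times N)$-matrices (all such norms are equivalent, so the choice is immaterial). A sequence $\{A_n\}\in\mathscr{A}^{\infty}$ is called $\mathscr{B}$-right-bounded if there exist a sequence $\{B_n\}\in\mathscr{B}^{\infty}$ and a constant $C'$ (both possibly depending on $\{A_n\}$) such that $\|A_nB_n\cdots A_1B_1\|\le C'$ for all $n=1,2,\ldots$. *)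

(* Defs.v *)
(* The real numbers are an arbitrary [R : realType]. *)
From mathcomp Require Import all_boot all_order all_algebra.
From mathcomp Require Import boolp classical_sets cardinality reals.
Set Implicit Arguments.
Unset Strict Implicit.
Unset Printing Implicit Defensive.

Import Order.TTheory GRing.Theory Num.Theory.
Local Open Scope classical_set_scope.
Local Open Scope ring_scope.

(* Nonnegativity is a consequence of these axioms.  The library's canonical
   norm on matrices is the max norm only, whence this predicate. *)
Record is_mxnorm (R : realType) (N : nat) (nu : 'M[R]_N -> R) : Prop := {
  mxnorm_eq0 : forall X, nu X = 0 -> X = 0;
  mxnormZ : forall (a : R) X, nu (a *: X) = `|a| * nu X;
  mxnorm_triangle : forall X Y, nu (X + Y) <= nu X + nu Y
}.

(* Sequences are indexed from 0: [u i] stands for the (i+1)-st term. *)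
Definition seqs_in (T : Type) (S : set T) : set (nat -> T) :=
  [set u | forall i, S (u i)].

(* [altprod A B n] is A_n B_n ... A_1 B_1 (with A_i, B_i being [A i.-1],
   [B i.-1]): later factors are multiplied on the left. *)
Fixpoint altprod (R : realType) (N M : nat)
    (A : nat -> 'M[R]_(N, M)) (B : nat -> 'M[R]_(M, N)) (n : nat) : 'M[R]_N :=
  if n is k.+1 then A k *m B k *m altprod A B k else 1%:M.

Definition right_bounded (R : realType) (N M : nat) (nu : 'M[R]_N -> R)
    (BB : set 'M[R]_(M, N)) (A : nat -> 'M[R]_(N, M)) : Prop :=
  exists2 B, seqs_in BB B &
    exists C' : R, forall n, (0 < n)%N -> nu (altprod A B n) <= C'.

(* Main.v *)
(* Suppose no uniform bound exists.  By compactness of BB^oo, for every C there is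
   then a finite word a over AA, of some length L, such that every choice of B's
   makes the norm exceed C within L steps.  Since all the products A *m B are
   invertible, multiplying on the right by l of them shrinks the norm at most by a
   factor k ^ l.  Hence after any finite word of length l one can append a bad word
   for C = k ^ l * i, which forces the norm above i for every choice of B's.  The
   infinite concatenation is a sequence which is not BB-right-bounded. *)
Require Import Defs.
From mathcomp Require Import all_boot all_order all_algebra.
From mathcomp Require Import boolp classical_sets cardinality reals.
From mathcomp Require Import topology normedtype derive.
Set Implicit Arguments.
Unset Strict Implicit.
Unset Printing Implicit Defensive.

Import Order.TTheory GRing.Theory Num.Theory.
Import numFieldNormedType.Exports.
Local Open Scope classical_set_scope.
Local Open Scope ring_scope.

Lemma seminorm_ge0 (R : realType) (V : lmodType R) (f : V -> R)
    (fZ : forall (a : R) v, f (a *: v) = `|a| * f v)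
    (fD : forall v w, f (v + w) <= f v + f w) (v : V) :
  0 <= f v.
Proof.
have := fD v (- v); rewrite subrr -(scaleN1r v) fZ normrN1 mul1r.
by rewrite -(scale0r v) fZ normr0 mul0r -mulr2n pmulrn_lge0.
Qed.

Lemma rV_seminorm_le (R : realType) (n : nat) (f : 'rV[R]_n -> R)
    (fZ : forall (a : R) v, f (a *: v) = `|a| * f v)
    (fD : forall v w, f (v + w) <= f v + f w) :
  exists2 c : R, 0 < c & forall v, f v <= c * `|v|.
Proof.
have f0 : f 0 = 0 by rewrite -(scale0r 0) fZ normr0 mul0r.
have f_ge0 := seminorm_ge0 fZ fD.
(* The sum comes from expanding [v] in the standard basis; the extra 1 keeps the constant positive
   even if [f] vanishes on that basis. *)
exists (1 + \sum_i f (delta_mx 0 i)); first by rewrite ltr_wpDr ?sumr_ge0.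
move=> v; rewrite mulrDl mul1r -[leLHS]add0r lerD//.
rewrite {1}(row_sum_delta v) mulr_suml.
have fsum (I : Type) (r : seq I) (F : I -> 'rV[R]_n) :
    f (\sum_(i <- r) F i) <= \sum_(i <- r) f (F i).
  elim: r => [|i r ih]; first by rewrite !big_nil f0.
  by rewrite !big_cons (le_trans (fD _ _))// lerD2l.
apply: (le_trans (fsum _ _ _)); apply: ler_sum => i _.
rewrite fZ mulrC ler_wpM2l// [leRHS]/Num.Def.normr/= mx_normrE.
by apply/bigmax_geP; right => /=; exists (0, i).
Qed.

(* By compactness, [f] attains a positive minimum on the unit sphere. *)
Lemma rV_norm_ge (R : realType) (n : nat) (f : 'rV[R]_n -> R)
    (f_eq0 : forall v, f v = 0 -> v = 0)
    (fZ : forall (a : R) v, f (a *: v) = `|a| * f v)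
    (fD : forall v w, f (v + w) <= f v + f w) :
  exists2 c : R, 0 < c & forall v, `|v| <= c * f v.
Proof.
have f0 : f 0 = 0 by rewrite -(scale0r 0) fZ normr0 mul0r.
have fN v : f (- v) = f v by rewrite -scaleN1r fZ normrN1 mul1r.
have f_ge0 := seminorm_ge0 fZ fD.
have [b b_gt0 fb] := rV_seminorm_le fZ fD.
have fcont : continuous f.
  move=> v; apply/(@cvgrPdist_lt _ _ _ _ (nbhs_filter v)) => e e_gt0.
  apply/nbhs_ballP; exists (e / b) => [|w]; first exact: divr_gt0.
  rewrite -ball_normE /= => vw.
  have fdist u u' : f u - f u' <= f (u - u').
    by rewrite lerBlDr -{1}(subrK u' u) fD.
  apply: (@le_lt_trans _ _ (b * `|v - w|)).
    rewrite (le_trans _ (fb _))// ler_norml fdist andbT lerNl opprB.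
    by rewrite -[f (v - w)]fN opprB fdist.
  by rewrite mulrC -ltr_pdivlMr.
pose S : set 'rV[R]_n := [set v | `|v| = 1].
(* If the sphere is empty, normalisation shows that [0] is the only vector, so any constant
   works. *)
have [[v0 Sv0]|S0] := pselect (S !=set0); last first.
  exists 1 => // v; have [->|v0] := eqVneq v 0; first by rewrite normr0 f0 mulr0.
  exfalso; apply: S0; exists (`|v|^-1 *: v).
  by rewrite /S/= normrZ normfV normr_id mulVf ?normr_eq0.
have Scomp : compact S.
  apply: bounded_closed_compact.
    by exists 1; split => // x x1 v /= ->; exact: ltW.
  apply: (@closed_comp _ _ (fun v : 'rV[R]_n => `|v|) [set 1]).
    by move=> v _; exact: norm_continuous.
  exact: closed_eq.
have [m mS fm] := EVT_min_rV (ex_intro _ _ Sv0) Scomp (continuous_subspaceT fcont).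
have fm_gt0 : 0 < f m.
  rewrite lt_neqAle f_ge0 andbT eq_sym; apply/eqP => /f_eq0 m0.
  by move: mS; rewrite inE /S/= m0 normr0 => /esym/eqP; rewrite oner_eq0.
exists (f m)^-1; rewrite ?invr_gt0// => v.
have [->|v0'] := eqVneq v 0; first by rewrite normr0 f0 mulr0.
have v_gt0 : 0 < `|v| by rewrite normr_gt0.
have : f m <= f (`|v|^-1 *: v).
  by apply: fm; rewrite inE /S/= normrZ normfV normr_id mulVf ?gt_eqF.
by rewrite fZ normfV normr_id mulrC ler_pdivlMr// mulrC ler_pdivlMl// mulrC.
Qed.

(** Since [Q] is invertible, [nu (X *m Q)] is again a norm of [X]; it is compared with [nu] through
    the max norm of [mxvec X]. *)
Lemma mxnorm_mulmx_unit (R : realType) (N : nat) (nu : 'M[R]_N -> R)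
    (nu_norm : is_mxnorm nu) (Q : 'M[R]_N) (Qunit : Q \in unitmx) :
  exists2 k : R, 0 < k & forall X, nu X <= k * nu (X *m Q).
Proof.
have [nu_eq0 nuZ nuD] := nu_norm.
have [||b b_gt0 nub] := @rV_seminorm_le R (N * N) (nu \o vec_mx).
- by move=> a v /=; rewrite linearZ nuZ.
- by move=> v w /=; rewrite linearD nuD.
have [|||c c_gt0 nuc] := @rV_norm_ge R (N * N) (fun v => nu (vec_mx v *m Q)).
- move=> v /nu_eq0/(congr1 (mulmx^~ (invmx Q))).
  by rewrite mulmxK// mul0mx => /(congr1 mxvec); rewrite vec_mxK linear0.
- by move=> a v; rewrite linearZ -scalemxAl nuZ.
- by move=> v w; rewrite linearD mulmxDl nuD.
exists (b * c); first exact: mulr_gt0.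
move=> X; have /= := nub (mxvec X); rewrite mxvecK => /le_trans; apply.
by rewrite -mulrA ler_pM2l//; have := nuc (mxvec X); rewrite mxvecK.
Qed.

(** Filters are stable under finite intersections. With [F] a neighbourhood of infinity, this turns
    thresholds depending on [s] into a common one. *)
Lemma finite_set_near (T : eqType) (S : set T) (I : Type) (F : set_system I)
    (FF : Filter F) (P : T -> I -> Prop) (S_fin : finite_set S)
    (SP : forall s, S s -> \forall i \near F, P s i) :
  \forall i \near F, forall s, S s -> P s i.
Proof.
move: S_fin SP => /finite_seqP[r ->]; elim: r => [|x r ih] SP.
  by apply: nearW => i s.
have Px : \forall i \near F, P x i by apply: SP; exact: mem_head.
have Pr : \forall i \near F, forall s, s \in r -> P s i.
  by apply: ih => s sr; apply: SP; rewrite /= inE; apply/orP; right.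
apply: filterS2 Px Pr => i Pxi Pri s /=.
by rewrite inE => /orP[/eqP->//|]; exact: Pri.
Qed.

(* [P i l w]: after [i] steps, the first [l] terms of [w] are final. *)
Lemma glue_prefixes (T : Type) (P : nat -> nat -> (nat -> T) -> Prop)
    (w0 : nat -> T) (P0 : P 0%N 0%N w0)
    (Pstep : forall i l w, P i l w -> exists l' w',
      [/\ (l < l')%N, forall t, (t < l)%N -> w' t = w t & P i.+1 l' w']) :
  exists u, forall i, exists l w,
    [/\ (i <= l)%N, P i l w & forall t, (t < l)%N -> u t = w t].
Proof.
have /choice[f fP] : forall x : nat * (nat * (nat -> T)),
    exists y : nat * (nat -> T), P x.1 x.2.1 x.2.2 ->
      [/\ (x.2.1 < y.1)%N, forall t, (t < x.2.1)%N -> y.2 t = x.2.2 t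
        & P x.1.+1 y.1 y.2].
  move=> [i [l w]]; have [/Pstep[l' [w' H]]|nP] := pselect (P i l w).
    by exists (l', w').
  by exists (l, w).
pose z := fix z n := if n is m.+1 then f (m, z m) else (0%N, w0).
have zP n : P n (z n).1 (z n).2.
  by elim: n => //= n /(fP (n, z n))[].
have zlt n : ((z n).1 < (z n.+1).1)%N by case: (fP (n, z n) (zP n)).
have zle n m : (n <= m)%N -> ((z n).1 <= (z m).1)%N.
  by move=> /subnK <-; elim: (m - n)%N => // d ih; exact: leq_trans (ltnW (zlt _)).
have zge n : (n <= (z n).1)%N by elim: n => // n ih; exact: leq_ltn_trans (zlt n).
have zstep n t : (t < (z n).1)%N -> (z n.+1).2 t = (z n).2 t.
  by case: (fP (n, z n) (zP n)) => _ + _; exact.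
have zagree n m t : (n <= m)%N -> (t < (z n).1)%N -> (z m).2 t = (z n).2 t.
  move=> /subnK <- tn; elim: (m - n)%N => // d ih.
  by rewrite addSn zstep// (leq_trans tn)// zle// leq_addl.
(* Diagonal sequence: the lengths grow strictly, so term [t] is final from step [t.+1] on. *)
exists (fun t => (z t.+1).2 t) => i; exists (z i).1, (z i).2; split => // t ti.
have [it|it] := leqP i t.+1; first exact: zagree.
by rewrite [RHS](zagree _ _ _ (ltnW it))// zge.
Qed.

(** Koenig's lemma for the finitely branching tree of words over [S]: a node with descendants at all
    levels has a child with the same property, and following such children gives an infinite
    branch. *)
Lemma konig_seqs_in (T : eqType) (S : set T) (S_fin : finite_set S)
    (Q : nat -> (nat -> T) -> Prop)
    (Qlocal : forall n u v, (forall t, (t < n)%N -> u t = v t) -> Q n u -> Q n v)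
    (QS : forall n, exists2 u, seqs_in S u & forall j, (j <= n)%N -> Q j u) :
  exists2 u, seqs_in S u & forall n, Q n u.
Proof.
(* [G n v]: the node [v_0 ... v_(n-1)] of the tree has descendants at all levels. *)
pose G n v := forall m, exists u, [/\ seqs_in S u,
  forall t, (t < n)%N -> u t = v t & forall j, (j <= m)%N -> Q j u].
have [w0 _ _] := QS 0%N.
have [||u uP] := @glue_prefixes T (fun i l w => l = i /\ G i w) w0.
- by split=> // m; have [u uS uQ] := QS m; exists u.
- move=> i _ w [-> Gw].
  suff [s _ Gs] : exists2 s, S s & G i.+1 (fun t => if t == i then s else w t).
    exists i.+1, (fun t => if t == i then s else w t); split => // t ti.
    by rewrite ltn_eqF.
  (* If every child [s] dies out at some level, then by finiteness all are dead at a common level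
     [m]; but [Gw m] yields a descendant passing through the child [u i]. *)
  apply: contrapT => noS.
  have : \forall m \near \oo, forall s, S s -> ~ exists u, [/\ seqs_in S u,
      forall t, (t < i.+1)%N -> u t = (if t == i then s else w t)
      & forall j, (j <= m)%N -> Q j u].
    apply: finite_set_near => // s Ss.
    have /existsNP[m0 nm0] : ~ G i.+1 (fun t => if t == i then s else w t).
      by move=> Gs; apply: noS; exists s.
    exists m0 => // m /= m0m [u [uS uw uQ]]; apply: nm0; exists u; split => //.
    by move=> j jm; apply: uQ; exact: leq_trans jm m0m.
  move=> [m _ /(_ m (leqnn m)) mP]; have [u [uS uw uQ]] := Gw m.
  apply: (mP (u i)) => //; exists u; split => // t.
  by rewrite ltnS leq_eqVlt; case: eqVneq => [->|_ /=] // /uw.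
exists u => n.
  have [_ [w [_ [-> Gw] uw]]] := uP n.+1; have [v [vS vw _]] := Gw 0%N.
  by rewrite uw// -vw//; exact: vS.
have [_ [w [_ [-> Gw] uw]]] := uP n; have [v [_ vw vQ]] := Gw n.
by apply: (Qlocal n v); [move=> t tn; rewrite vw// uw|exact: vQ].
Qed.

Lemma eq_altprod (R : realType) (N M n : nat)
    (A A' : nat -> 'M[R]_(N, M)) (B B' : nat -> 'M[R]_(M, N)) :
  (forall t, (t < n)%N -> A t = A' t) -> (forall t, (t < n)%N -> B t = B' t) ->
  altprod A B n = altprod A' B' n.
Proof.
elim: n => //= n ih AA' BB'; rewrite AA'// BB'// ih// => t tn.
  by apply: AA'; exact: ltnW.
by apply: BB'; exact: ltnW.
Qed.

Lemma altprodD (R : realType) (N M n l : nat)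
    (A : nat -> 'M[R]_(N, M)) (B : nat -> 'M[R]_(M, N)) :
  altprod A B (n + l) =
  altprod (fun t => A (t + l)%N) (fun t => B (t + l)%N) n *m altprod A B l.
Proof. by elim: n => [|n ih] /=; rewrite ?mul1mx// ih !mulmxA. Qed.

(** Each of the finitely many products [A *m B] has its own constant, and enlarging a constant
    preserves the bound, so one [k] serves them all; it is then applied once per factor. *)
Lemma mxnorm_le_altprod (R : realType) (N M : nat) (nu : 'M[R]_N -> R)
    (nu_norm : is_mxnorm nu) (AA : set 'M[R]_(N, M)) (BB : set 'M[R]_(M, N))
    (AA_fin : finite_set AA) (BB_fin : finite_set BB)
    (det_neq0 : forall A B, AA A -> BB B -> \det (A *m B) != 0) :
  exists2 k : R, 0 < k & forall A B, seqs_in AA A -> seqs_in BB B ->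
    forall n X, nu X <= k ^+ n * nu (X *m altprod A B n).
Proof.
have nu_ge0 := seminorm_ge0 (mxnormZ nu_norm) (mxnorm_triangle nu_norm).
have near_k : \forall k \near +oo, forall A, AA A -> forall B, BB B ->
    forall X, nu X <= k * nu (X *m (A *m B)).
  apply: finite_set_near => // A AAA; apply: finite_set_near => // B BBB.
  have [|k0 k0_gt0 nuk0] := @mxnorm_mulmx_unit _ _ _ nu_norm (A *m B).
    by rewrite unitmxE unitfE det_neq0.
  apply: filterS (nbhs_pinfty_ge (num_real k0)) => k /= k0k X.
  by apply: le_trans (nuk0 X) _; rewrite ler_wpM2r.
have [k [k_gt0 nuk]] := filter_ex (filterI (nbhs_pinfty_gt (num_real 0)) near_k).
exists k => // A B AAA BBB; elim => [|n ih] X; first by rewrite mulmx1 mul1r.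
rewrite /= mulmxA exprSr -mulrA mulrCA (le_trans (nuk _ (AAA n) _ (BBB n) X))//.
by rewrite ler_pM2l.
Qed.

Theorem theorem1 (R : realType) (N M : nat) (N_ge1 : (1 <= N)%N) (M_ge1 : (1 <= M)%N)
    (nu : 'M[R]_N -> R) (nu_norm : is_mxnorm nu)
    (AA : set 'M[R]_(N, M)) (BB : set 'M[R]_(M, N))
    (AA_fin : finite_set AA) (BB_fin : finite_set BB)
    (det_neq0 : forall A B, AA A -> BB B -> \det (A *m B) != 0)
    (AA_bounded : forall A, seqs_in AA A -> right_bounded nu BB A) :
  exists2 C : R, 0 < C &
    forall A, seqs_in AA A ->
      exists2 B, seqs_in BB B &
        forall n, (0 < n)%N -> nu (altprod A B n) <= C.
Proof.
apply: contrapT => noC.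
(* Koenig's lemma, contraposed, is what makes [L] independent of [B]. *)
have bad C : 0 < C -> exists2 A, seqs_in AA A & exists L, forall B,
    seqs_in BB B -> exists n, [/\ (0 < n)%N, (n <= L)%N & C < nu (altprod A B n)].
  move=> C_gt0; apply: contrapT => noA; apply: noC; exists C => // A AAA.
  apply: konig_seqs_in => // [n B B' BB' H n0|L].
    by rewrite -(eq_altprod (fun t _ => erefl (A t)) BB') H.
  apply: contrapT => noB; apply: noA; exists A => //; exists L => B BBB.
  apply: contrapT => non; apply: noB; exists B => // n nL n0.
  by rewrite leNgt; apply/negP => Cn; apply: non; exists n.
have [k k_gt0 nuk] := mxnorm_le_altprod nu_norm AA_fin BB_fin det_neq0.
have [w0 w0A _] := bad 1 ltr01.
(* The first [l] terms of [w] force the norm above [i] whatever [B] is. The guard [0 < i] lets the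
   construction start from the empty prefix of [w0]. *)
pose P i l w := seqs_in AA w /\ forall B, seqs_in BB B -> (0 < i)%N ->
  exists n, [/\ (0 < n)%N, (n <= l)%N & i%:R < nu (altprod w B n)].
have [||A AP] := @glue_prefixes _ P w0.
- by split.
- move=> i l w [wA _].
  have [|a aA [L aL]] := bad (k ^+ l * i.+1%:R).
    by rewrite mulr_gt0// exprn_gt0.
  pose w' t := if (t < l)%N then w t else a (t - l)%N.
  (* [L.+1] rather than [L] makes the prefix strictly longer even when [L] is 0. *)
  exists (L.+1 + l)%N, w'; split; [by rewrite addSn ltnS leq_addl| |split].
  + by move=> t tl; rewrite /w' tl.
  + by move=> t; rewrite /w'; case: ifP => _; [exact: wA|exact: aA].
  move=> B BBB _; have [|n [n0 nL Cn]] := aL (fun t => B (t + l)%N).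
    by move=> t; exact: BBB.
  exists (n + l)%N; split.
  + by rewrite addn_gt0 n0.
  + by rewrite leq_add2r ltnW.
  (* The product over the bad word exceeds [k ^+ l * i.+1%:R], and the [l] earlier factors on its
     right cost at most [k ^+ l]. *)
  rewrite -(ltr_pM2l (exprn_gt0 l k_gt0)) (lt_le_trans Cn)//.
  rewrite (le_trans (nuk _ _ wA BBB l _))// altprodD.
  rewrite (@eq_altprod _ _ _ l w' w B B)//; last by move=> t tl; rewrite /w' tl.
  rewrite (@eq_altprod _ _ _ n (fun t => w' (t + l)%N) a _ (fun t => B (t + l)%N))//.
  by move=> t _; rewrite /w' ltnNge leq_addl addnK.
have [|B BBB [C' BC']] := AA_bounded A.
  move=> t; have [l [w [tl [wA _] Aw]]] := AP t.+1.
  by rewrite Aw//; exact: wA.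
(* An integer above [C']; the successor makes it positive, as the guard in [P] demands. *)
have [l [w [_ [_ wP] Aw]]] := AP (Num.bound `|C'|).+1.
have [//|//|n [n0 nl]] := wP B; apply/negP; rewrite -leNgt.
rewrite -(@eq_altprod _ _ _ _ A w B B)//; last first.
  by move=> t tn; apply: Aw; exact: leq_trans nl.
rewrite (le_trans (BC' n n0))// (le_trans (ler_norm C'))//.
by rewrite (le_trans (ltW (archi_boundP _)))// ler_nat.
Qed.
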